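(* For every $M>0$ there is $N$ such that every finite poset $P$ with $w(P)\ge N$ satisfies $\mathrm{win}(P)\ge M$.
   Context: For a finite poset $P$ with $n$ elements, $f$ is a uniformly random linear extension (order-preserving bijection $P\to\{1,\dots,n\}$). For $x\in P$, let $r(x)=\min\{f(y):y>x\}$ (defined as $n+1$ if $x$ is maximal) and $q(x)=\max\{f(y):y<x\}$ (defined as $0$ if $x$ is minimal); $\mathrm{win}(x)=\mathbb{E}[r(x)-q(x)]$ and $\mathrm{win}(P)=\max_{x\in P}\mathrm{win}(x)$. $w(P)$ is the width (maximum antichain size). *)

(* Defs.v *)
From mathcomp Require Import all_boot all_order all_algebra.
From mathcomp Require Import reals.

Set Implicit Arguments.
Unset Strict Implicit.
Unset Printing Implicit Defensive.

Import Order.TTheory GRing.Theory Num.Theory.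

Section Poset.
Context {d : Order.disp_t} (T : finPOrderType d).
Implicit Types (x y : T) (A : {set T}) (f : {ffun T -> 'I_#|T|}).

Definition antichain A : bool :=
  [forall x in A, forall y in A, (x <= y)%O ==> (x == y)].

Definition width : nat := \max_(A : {set T} | antichain A) #|A|.

(* The codomain 'I_#|T| is 0-based; [label] shifts it to {1, ..., #|T|}.      *)
(* Since the domain and codomain have equal size, injective means bijective.  *)
Definition linear_extension f : bool :=
  injectiveb f && [forall x, forall y, (x <= y)%O ==> (f x <= f y)].

Definition linear_extensions : {set {ffun T -> 'I_#|T|}} :=
  [set f | linear_extension f].

Definition label f x : nat := (f x).+1.

(* Labels lie in {1, ..., #|T|}, so the initial values #|T|.+1 and 0 only     *)
(* matter when x is maximal, resp. minimal.                                   *)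
Definition upper_end f x : nat :=
  \big[minn/#|T|.+1]_(y : T | (x < y)%O) label f y.

Definition lower_end f x : nat := \max_(y : T | (y < x)%O) label f y.

Local Open Scope ring_scope.

Definition mean_linext (R : realType) (X : {ffun T -> 'I_#|T|} -> R) : R :=
  (\sum_(f in linear_extensions) X f) / #|linear_extensions|%:R.

Definition window (R : realType) x : R :=
  mean_linext (fun f => (upper_end f x)%:R - (lower_end f x)%:R).

(* Every [window R x] is positive, so the initial value 0 only matters when T *)
(* is empty.                                                                  *)
Definition poset_window (R : realType) : R :=
  \big[Num.max/0]_(x : T) window R x.

End Poset.

(* Main.v *)
(* Let A be an antichain, D the set of elements strictly below A and R its
   complement. A linear extension amounts to a word in the letters D and R
   together with an order of D and an order of R; moving D-letters earlier in
   the word again gives a linear extension.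

   If all windows of A have bounded mean, a positive fraction of the pairs
   (f, a) are close: r(a) - q(a) <= g. Moving the D-letter at q(a) earlier
   shows that a block of bounded length L before q(a) mostly contains l
   D-letters, and dually for R-letters after r(a). For two such a, b with a
   far to the left of b, exchange l R-letters right after r(a) with l
   D-letters right before q(b). This pushes apart the ends of every window
   between the two blocks, so that none of them is close any more: b is
   nearly the next close element after a, and the exchange can be undone from
   a and a bounded amount of information. Hence the number K of good elements
   of A satisfies E[K^2] = O(|A|), whereas E[K] >= |A| / 4; so |A| is bounded. *)

Require Import Defs.
From mathcomp Require Import all_boot all_order all_algebra.
From mathcomp Require Import reals.
From mathcomp Require Import zify.

Set Implicit Arguments.
Unset Strict Implicit.
Unset Printing Implicit Defensive.

Import Order.TTheory GRing.Theory Num.Theory.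

(** * Binary words *)

Section Words.
Implicit Types (w v : pred nat) (i j k s n L l : nat).

Definition cnt w k := count w (iota 0 k).

Lemma cntS w k : cnt w k.+1 = cnt w k + w k.
Proof. by rewrite /cnt -addn1 iotaD count_cat /= addn0. Qed.

Lemma leq_cnt w i j : i <= j -> cnt w i <= cnt w j.
Proof. by move=> /subnKC <-; rewrite /cnt iotaD count_cat leq_addr. Qed.

Lemma leq_cnt_add w i j : cnt w (i + j) <= cnt w i + j.
Proof.
rewrite /cnt iotaD count_cat leq_add2l.
by rewrite (leq_trans (count_size _ _)) // size_iota.
Qed.

Lemma cnt_predC w k : cnt w k + cnt (predC w) k = k.
Proof. by rewrite /cnt count_predC size_iota. Qed.

Lemma ltn_cnt w i k : w i -> (cnt w i < cnt w k) = (i < k).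
Proof.
move=> wi; case: (ltnP i k) => [ik|ki]; last by rewrite ltnNge leq_cnt.
by have := leq_cnt w ik; rewrite cntS wi addn1.
Qed.

Lemma cnt_inj w i j : w i -> w j -> cnt w i = cnt w j -> i = j.
Proof.
move=> wi wj e; have := ltn_cnt j wi; have := ltn_cnt i wj.
by rewrite e !ltnn; lia.
Qed.

Lemma eq_cnt w v k : (forall i, i < k -> w i = v i) -> cnt w k = cnt v k.
Proof.
by move=> e; apply: eq_in_count => i; rewrite mem_iota add0n; apply: e.
Qed.

Lemma cnt_nth w k n : k < cnt w n -> exists i, [/\ i < n, w i & cnt w i = k].
Proof.
elim: n => [//|n IH]; rewrite cntS.
case: (ltnP k (cnt w n)) => [/IH[i [ni wi e]] _|le].
  by exists i; split=> //; apply: leq_trans ni _.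
by case wn: (w n) => lt; [exists n; split=> //; lia|lia].
Qed.

Lemma cnt_mono w v s k : s <= k ->
  (forall i, s <= i < k -> w i -> v i) ->
  cnt w k + cnt v s <= cnt v k + cnt w s.
Proof.
move=> /subnKC <-; elim: (k - s) => [|m IH] wv; first by rewrite addn0 addnC.
rewrite addnS !cntS.
have /IH : forall i, s <= i < s + m -> w i -> v i by move=> i hi; apply: wv; lia.
have := wv (s + m); case: (w _); case: (v _) => //=; lia.
Qed.

Lemma cnt_shift w v s k : s <= k ->
  (forall i, s <= i < k -> v i = w i) ->
  cnt v k + cnt w s = cnt w k + cnt v s.
Proof.
move=> sk e; apply/eqP; rewrite eqn_leq.
by rewrite !cnt_mono // => i hi; rewrite (e _ hi).
Qed.

(** The hypothesis provides [l] zeros in the block; the last [l] of them become ones, by induction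
    on the block length. *)
Lemma cnt_raise w s L l : l + cnt w (s + L) <= cnt w s + L ->
  exists v, [/\ forall i, ~~ (s <= i < s + L) -> v i = w i,
                forall i, w i -> v i &
                cnt v (s + L) = cnt w (s + L) + l].
Proof.
elim: L l => [|L IH] l.
  rewrite addn0 => h; exists w; split=> //; lia.
rewrite addnS cntS; case wsL: (w (s + L)) => h.
  have [|v [v1 v2 v3]] := IH l; first lia.
  exists v; split=> // [i hi|]; first by apply: v1; lia.
  by rewrite cntS v2 ?wsL // v3; lia.
case: l h => [|l] h; first by exists w; split=> //; rewrite cntS wsL !addn0.
have [|v [v1 v2 v3]] := IH l; first lia.
exists (fun i => (i == s + L) || v i); split=> [i hi|i wi|].
- by rewrite v1; [case: eqP => // ?; lia|lia].
- by rewrite v2 ?orbT.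
rewrite cntS eqxx /= -(@eq_cnt v); first lia.
by move=> i hi; case: eqP => // ?; lia.
Qed.

(* Trading l zeros of an early block for l ones of a late one. *)
Lemma cnt_exchange w s1 s2 L l : s1 + L <= s2 ->
  l + cnt w (s1 + L) <= cnt w s1 + L -> l + cnt w s2 <= cnt w (s2 + L) ->
  exists v, [/\ forall i, ~~ (s1 <= i < s1 + L) -> ~~ (s2 <= i < s2 + L) ->
                  v i = w i,
                forall k, cnt w k <= cnt v k,
                forall k, (k <= s1) || (s2 + L <= k) -> cnt v k = cnt w k &
                forall k, s1 + L <= k <= s2 -> cnt v k = cnt w k + l].
Proof.
move=> s12 h1 h2.
have [v [v1 v2 v3]] := cnt_raise h1.
have vmid k : s1 + L <= k -> cnt v k = cnt w k + l.
  move=> hk; have := @cnt_shift w v _ _ hk; rewrite v3 => e.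
  suff: cnt v k + cnt w (s1 + L) = cnt w k + (cnt w (s1 + L) + l) by lia.
  by apply: e => i hi; apply: v1; lia.
(* Deleting ones from [v] amounts to raising its complement, so the exchanged word is [predC u]. *)
have [|u [u1 u2 u3]] := @cnt_raise (predC v) s2 L l.
  have := cnt_predC v (s2 + L); have := cnt_predC v s2.
  rewrite !vmid; lia.
have uv i : ~~ u i -> v i by apply: contraNT => vi; apply: u2.
have E i : ~~ (s2 <= i < s2 + L) -> ~~ u i = v i.
  by move=> /u1 ->; rewrite /= negbK.
have agree i : ~~ (s1 <= i < s1 + L) -> ~~ (s2 <= i < s2 + L) ->
    predC u i = w i by move=> a1 a2; rewrite /= E // v1.
have low k : k <= s2 -> cnt (predC u) k = cnt v k.
  by move=> hk; apply: eq_cnt => i hi; rewrite /= E //; lia.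
have e2 : cnt (predC u) (s2 + L) = cnt w (s2 + L).
  have := cnt_predC u (s2 + L); have := cnt_predC v (s2 + L).
  rewrite vmid; lia.
have high k : s2 + L <= k -> cnt (predC u) k = cnt w k.
  move=> hk; have := @cnt_shift w (predC u) _ _ hk; rewrite e2 => h.
  by apply/eqP; rewrite -(eqn_add2r (cnt w (s2 + L))) h // => i hi; apply: agree; lia.
exists (predC u); split=> // [k|k /orP[hk|]|k /andP[a1 a2]]; last 2 first.
- exact: high.
- by rewrite low // vmid.
- have [le|lt] := leqP k s2.
    rewrite low //; have := @cnt_mono w v 0 k isT (fun i _ => v2 i).
    by rewrite /cnt /= !addn0.
  have [le2|gt] := leqP k (s2 + L); last by rewrite high //; lia.
  (* Inside the late block, prefixes are compared from its right end, where both counts agree: on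
     the remaining part [predC u] has no more ones than [w]. *)
  have := @cnt_mono (predC u) w _ _ le2.
  rewrite e2 => h; suff: cnt w (s2 + L) + cnt w k <= cnt w (s2 + L) + cnt (predC u) k by lia.
  apply: h => i hi /uv vi; rewrite -v1 //; lia.
- by rewrite low; [apply: eq_cnt => i hi; apply: v1; lia|lia].
Qed.

End Words.

(** * Relabelling a linear extension along a word *)

Section Relabelling.
Context {d : Order.disp_t} (T : finPOrderType d) (D : {set T}).
Implicit Types (x y a : T) (f : {ffun T -> 'I_#|T|}) (w v : pred nat).

Definition word f : pred nat := fun i => [exists x in D, f x == i :> nat].

Definition letter (b : bool) w : pred nat := fun i => w i == b.

(** Each element keeps its rank among the letters of its own kind. For injective [f] and [f'] this
    means equal orders on [D] and equal orders on its complement; only the word may change. *)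
Definition relabels f f' := forall x,
  cnt (letter (x \in D) (word f)) (f x) =
  cnt (letter (x \in D) (word f')) (f' x).

Lemma cnt_letter_true w k : cnt (letter true w) k = cnt w k.
Proof. by apply: eq_cnt => i _; rewrite /letter eqb_id. Qed.

Lemma cnt_letter_false w k : cnt (letter false w) k = cnt (predC w) k.
Proof. by apply: eq_cnt => i _; rewrite /letter eqbF_neg. Qed.

Lemma leq_cnt_letter_false w v k :
  (cnt (letter false w) k <= cnt (letter false v) k) = (cnt v k <= cnt w k).
Proof.
rewrite !cnt_letter_false; have := cnt_predC w k; have := cnt_predC v k; lia.
Qed.

Lemma word_val f x : injective f -> word f (f x) = (x \in D).
Proof.
move=> f_inj; apply/existsP/idP => [[y /andP[yD /eqP/val_inj/f_inj <-]] //|xD].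
by exists x; rewrite xD eqxx.
Qed.

Lemma letter_val f x : injective f -> letter (x \in D) (word f) (f x).
Proof. by move=> f_inj; rewrite /letter word_val. Qed.

Lemma inj_surj f i : injective f -> i < #|T| -> exists x, f x = i :> nat.
Proof.
move=> f_inj ni; have [|g _ gK] := inj_card_bij f_inj; first by rewrite card_ord.
by exists (g (Ordinal ni)); rewrite gK.
Qed.

(** The element of rank k among its kind goes to the k-th occurrence of its letter in [v]; equal
    totals of D-letters leave enough positions for both kinds. *)
Lemma relabel_exists f v : injective f -> cnt v #|T| = cnt (word f) #|T| ->
  exists f', [/\ injective f', relabels f f' &
                 forall i, i < #|T| -> word f' i = v i].
Proof.
move=> f_inj cv.
have ex x : exists i : 'I_#|T|, letter (x \in D) v i /\
    cnt (letter (x \in D) v) i = cnt (letter (x \in D) (word f)) (f x).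
  have [|i [ni vi ci]] :=
    @cnt_nth (letter (x \in D) v) (cnt (letter (x \in D) (word f)) (f x)) #|T|.
    have -> : cnt (letter (x \in D) v) #|T| =
              cnt (letter (x \in D) (word f)) #|T|.
      case: (x \in D); first by rewrite !cnt_letter_true.
      by apply/eqP; rewrite eqn_leq !leq_cnt_letter_false cv leqnn.
    by rewrite ltn_cnt ?letter_val.
  by exists (Ordinal ni).
have [h hP] := fin_all_exists ex.
have f'E x : (finfun h) x = h x by rewrite ffunE.
have h_inj : injective (finfun h).
  move=> x y; rewrite !f'E => hxy; apply: (f_inj); apply: val_inj => /=.
  have [/eqP vx cx] := hP x; have [/eqP vy cy] := hP y.
  have xyD : (y \in D) = (x \in D) by rewrite -vx -vy hxy.
  apply: (@cnt_inj (letter (x \in D) (word f))); first by apply: letter_val.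
    by rewrite -xyD letter_val.
  by rewrite -cx hxy -xyD cy.
have wh i : i < #|T| -> word (finfun h) i = v i.
  move=> ni; have [x <-] := inj_surj h_inj ni.
  by rewrite word_val // f'E; have [/eqP] := hP x.
exists (finfun h); split=> // x.
rewrite f'E -(proj2 (hP x)); apply: eq_cnt => i hi.
by rewrite /letter wh // (ltn_trans hi).
Qed.

Lemma relabels_sym f f' : relabels f f' -> relabels f' f.
Proof. by move=> r x; rewrite r. Qed.

Lemma relabels_lt f f' x k k' : injective f -> injective f' -> relabels f f' ->
  cnt (letter (x \in D) (word f')) k' <= cnt (letter (x \in D) (word f)) k ->
  f' x < k' -> f x < k.
Proof.
move=> f_inj f'_inj r ck; rewrite -(ltn_cnt k' (letter_val x f'_inj)) -r.
by move=> /leq_trans/(_ ck); rewrite ltn_cnt // letter_val.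
Qed.

(** A labelling is recovered from its word and the two orders, and [f'] carries both orders. This is
    how all encodings below are decoded. *)
Lemma relabels_inj f1 f2 f' : injective f1 -> injective f2 ->
  relabels f1 f' -> relabels f2 f' ->
  (forall i, i < #|T| -> word f1 i = word f2 i) -> f1 = f2.
Proof.
move=> i1 i2 r1 r2 e; apply/ffunP => x; apply: val_inj => /=.
have E k : k <= #|T| -> cnt (letter (x \in D) (word f1)) k =
    cnt (letter (x \in D) (word f2)) k.
  by move=> hk; apply: eq_cnt => i hi; rewrite /letter e // (leq_trans hi).
apply: (@cnt_inj (letter (x \in D) (word f1))); first by apply: letter_val.
  by rewrite /letter e ?ltn_ord // word_val.
by rewrite r1 -r2 -E // ltnW.
Qed.

(** * Linear extensions under relabelling *)

Hypothesis D_down : forall x y, (x <= y)%O -> y \in D -> x \in D.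

Lemma linext_inj f : f \in linear_extensions T -> injective f.
Proof. by rewrite inE => /andP[/injectiveP]. Qed.

Lemma linext_le f x y :
  f \in linear_extensions T -> (x <= y)%O -> f x <= f y.
Proof. by rewrite inE => /andP[_ /forallP/(_ x)/forallP/(_ y)/implyP]; apply. Qed.

Lemma linext_lt f x y :
  f \in linear_extensions T -> (x < y)%O -> f x < f y.
Proof.
move=> fL xy; rewrite ltn_neqAle linext_le ?ltW // andbT.
by apply: contraTN xy => /eqP/val_inj/(linext_inj fL) ->; rewrite ltxx.
Qed.

(* Moving the labels of the down-set D earlier keeps every constraint. *)
Lemma relabels_linext f f' : f \in linear_extensions T -> injective f' ->
  relabels f f' -> (forall k, cnt (word f) k <= cnt (word f') k) ->
  f' \in linear_extensions T.
Proof.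
move=> fL f'_inj r dom; have f_inj := linext_inj fL.
rewrite inE; apply/andP; split; first exact/injectiveP.
apply/forallP => x; apply/forallP => y; apply/implyP => xy.
have fxy := linext_le fL xy.
case: (boolP (y \in D)) => yD.
  have xD := D_down xy yD.
  rewrite leqNgt -(ltn_cnt _ (letter_val y f'_inj)) yD -leqNgt.
  have := r x; have := r y; rewrite xD yD => <- <-; exact: leq_cnt.
(* With [x] in [D] and [y] outside, [f' x <= f x <= f y <= f' y]; elements of the same kind keep
   their relative order. *)
case: (boolP (x \in D)) => xD.
  apply: (@leq_trans (f x)).
    rewrite -ltnS; apply: (relabels_lt f'_inj f_inj (relabels_sym r) _ (ltnSn _)).
    by rewrite xD !cnt_letter_true.
  apply: leq_trans fxy _.
  rewrite -ltnS; apply: (relabels_lt f_inj f'_inj r _ (ltnSn _)).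
  by rewrite (negbTE yD) leq_cnt_letter_false.
rewrite leqNgt -(ltn_cnt _ (letter_val y f'_inj)) (negbTE yD) -leqNgt.
have := r x; have := r y; rewrite (negbTE xD) (negbTE yD) => <- <-.
exact: leq_cnt.
Qed.

(** D-letters move from the late block to the early one, so prefix counts only grow and
    [relabels_linext] applies. *)
Lemma linext_exchange f s1 s2 L l : f \in linear_extensions T ->
  s1 + L <= s2 -> s2 + L <= #|T| ->
  l + cnt (word f) (s1 + L) <= cnt (word f) s1 + L ->
  l + cnt (word f) s2 <= cnt (word f) (s2 + L) ->
  exists f', [/\ f' \in linear_extensions T, relabels f f',
    forall i, ~~ (s1 <= i < s1 + L) -> ~~ (s2 <= i < s2 + L) ->
      word f' i = word f i,
    forall k, (k <= s1) || (s2 + L <= k) ->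
      cnt (word f') k = cnt (word f) k &
    forall k, s1 + L <= k <= s2 -> cnt (word f') k = cnt (word f) k + l].
Proof.
move=> fL h12 h2n h1 h2.
have [v [v1 v2 v3 v4]] := cnt_exchange h12 h1 h2.
have [|f' [f'_inj r wv]] := relabel_exists (v := v) (linext_inj fL).
  by apply: v3; rewrite h2n orbT.
(* Words are false beyond the last position, which frees the conclusions from any bound on [i] and
   [k]. *)
have out (g : {ffun T -> 'I_#|T|}) i : #|T| <= i -> word g i = false.
  move=> ni; apply/existsP => -[x /andP[_ /eqP xi]].
  by have := ltn_ord (g x); rewrite xi; lia.
have agree i : ~~ (s1 <= i < s1 + L) -> ~~ (s2 <= i < s2 + L) ->
    word f' i = word f i.
  move=> a b; case: (ltnP i #|T|) => ni; first by rewrite wv // v1.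
  by rewrite !out.
have cv k : k <= #|T| -> cnt (word f') k = cnt v k.
  by move=> hk; apply: eq_cnt => i hi; rewrite wv // (leq_trans hi).
have chigh k : (k <= s1) || (s2 + L <= k) -> cnt (word f') k = cnt (word f) k.
  case: (leqP k #|T|) => [hk|nk] hk'; first by rewrite cv // v3.
  have := @cnt_shift (word f) (word f') _ _ (ltnW nk).
  rewrite (cv #|T|) // v3 ?h2n ?orbT // => e; apply/eqP.
  rewrite -(eqn_add2r (cnt (word f) #|T|)) e // => i hi.
  by rewrite !out //; lia.
exists f'; split=> //; last by move=> k hk; rewrite cv ?v4 //; lia.
apply: relabels_linext r _ => // k; case: (leqP k #|T|) => hk.
  by rewrite cv.
by rewrite chigh //; lia.
Qed.

(** * Ends of windows and prefix counts *)

Lemma lower_end_leP f a k :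
  reflect (forall y, (y < a)%O -> f y < k) (lower_end f a <= k).
Proof. exact: bigmax_leqP. Qed.

Lemma upper_end_le_label f a y : (a < y)%O -> upper_end f a <= label f y.
Proof.
move=> ay; rewrite /upper_end; elim: index_enum (mem_index_enum y) => // z s IH.
rewrite inE big_cons => /predU1P[<-|/IH {}IH]; first by rewrite ay geq_minl.
by case: ifP => // _; rewrite geq_min IH orbT.
Qed.

Lemma upper_end_gtP f a k : k <= #|T| ->
  reflect (forall y, (a < y)%O -> k <= f y) (k < upper_end f a).
Proof.
move=> nk; apply: (iffP idP) => [h y ay|h].
  by rewrite -ltnS (leq_trans h) // upper_end_le_label.
by rewrite /upper_end; elim/big_rec: _ => [//|y u ay hu]; rewrite leq_min hu ltnS h.
Qed.

Lemma upper_end_le f a : upper_end f a <= #|T|.+1.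
Proof.
by rewrite /upper_end; elim/big_rec: _ => [//|y u ay hu]; rewrite geq_min hu orbT.
Qed.

Lemma lower_end_le_val f a : f \in linear_extensions T -> lower_end f a <= f a.
Proof. by move=> fL; apply/lower_end_leP => y; apply: linext_lt. Qed.

Lemma upper_end_gt_val f a :
  f \in linear_extensions T -> (f a).+1 < upper_end f a.
Proof. by move=> fL; apply/upper_end_gtP => // y; apply: linext_lt. Qed.

(** Positivity excludes the default value 0 of a minimal element. The last predecessor sits at the
    0-based position [(lower_end f a).-1]. *)
Lemma lower_end_ex f a : 0 < lower_end f a ->
  exists2 y, (y < a)%O & lower_end f a = (f y).+1.
Proof.
move=> h; have: ~~ (lower_end f a <= (lower_end f a).-1) by lia.
move=> /lower_end_leP hn.
have /existsP[y /andP[ya hy]] :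
    [exists y, (y < a)%O && ((lower_end f a).-1 <= f y)].
  apply/contraT => /existsPn hh; case: hn => y ya.
  by have := hh y; rewrite ya /= -ltnNge.
exists y => //; have /lower_end_leP/(_ y ya) := leqnn (lower_end f a); lia.
Qed.

Lemma upper_end_ex f a : upper_end f a <= #|T| ->
  exists2 y, (a < y)%O & upper_end f a = (f y).+1.
Proof.
move=> h; have: ~~ (upper_end f a < upper_end f a) by lia.
move=> /(upper_end_gtP f a h) hn.
have /existsP[y /andP[ya hy]] :
    [exists y, (a < y)%O && (f y < upper_end f a)].
  apply/contraT => /existsPn hh; case: hn => y ya.
  by have := hh y; rewrite ya /= -leqNgt.
exists y => //; case: (posnP (upper_end f a)) => [e|u0]; first by rewrite e in hy.
have u1 : (upper_end f a).-1 <= #|T| by lia.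
have : (upper_end f a).-1 < upper_end f a by lia.
by move=> /(upper_end_gtP f a u1)/(_ y ya); lia.
Qed.

Section Side.
Variables (f f' : {ffun T -> 'I_#|T|}) (a : T).
Hypothesis D_lower : forall y, (y < a)%O -> y \in D.
Hypothesis D_upper : forall y, (a < y)%O -> y \notin D.
Hypotheses (f_inj : injective f) (f'_inj : injective f') (r : relabels f f').

(** All predecessors of [a] are D-letters of fixed rank, so whether they lie among the first [k]
    positions depends only on the number of D-letters there. *)
Lemma relabels_lower_end k k' : cnt (word f') k' <= cnt (word f) k ->
  lower_end f' a <= k' -> lower_end f a <= k.
Proof.
move=> ck /lower_end_leP h; apply/lower_end_leP => y ya.
by apply: relabels_lt (h y ya) => //; rewrite D_lower // !cnt_letter_true.
Qed.

Lemma relabels_upper_end k k' : k <= #|T| -> k' <= #|T| ->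
  cnt (predC (word f)) k <= cnt (predC (word f')) k' ->
  k' < upper_end f' a -> k < upper_end f a.
Proof.
move=> kn kn' ck /(upper_end_gtP f' a kn') h; apply/upper_end_gtP => // y ya.
rewrite leqNgt; apply/negP.
move=> /(relabels_lt (k := k') f'_inj f_inj (relabels_sym r)) hh.
have := h y ya; rewrite leqNgt hh //.
by rewrite (negbTE (D_upper ya)) !cnt_letter_false.
Qed.

End Side.

Lemma relabels_lower_end_eq f f' a k :
  (forall y, (y < a)%O -> y \in D) -> injective f -> injective f' ->
  relabels f f' -> cnt (word f') k = cnt (word f) k ->
  (lower_end f' a <= k) = (lower_end f a <= k).
Proof.
move=> aD i i' r e; apply/idP/idP; first by apply: (relabels_lower_end aD i i' r); rewrite e.
by apply: (relabels_lower_end aD i' i (relabels_sym r)); rewrite e.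
Qed.

Lemma relabels_upper_end_eq f f' a k : k <= #|T| ->
  (forall y, (a < y)%O -> y \notin D) -> injective f -> injective f' ->
  relabels f f' -> cnt (word f') k = cnt (word f) k ->
  (k < upper_end f' a) = (k < upper_end f a).
Proof.
move=> nk aD i i' r e; have e' : cnt (predC (word f')) k = cnt (predC (word f)) k.
  have := cnt_predC (word f') k; have := cnt_predC (word f) k; lia.
apply/idP/idP; first by apply: (relabels_upper_end aD i i' r); rewrite ?e'.
by apply: (relabels_upper_end aD i' i (relabels_sym r)); rewrite ?e'.
Qed.

End Relabelling.

(** * Runs next to a short window *)

(** An injection given by a decodable relation, so that codes need only exist and no encoding
    function has to be written down. *)
Lemma leq_card_rel (X Y : finType) (S : {pred X}) (Z : {pred Y})
    (Q : X -> Y -> Prop) :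
  (forall x, x \in S -> exists2 y, y \in Z & Q x y) ->
  (forall x1 x2 y, x1 \in S -> x2 \in S -> Q x1 y -> Q x2 y -> x1 = x2) ->
  #|S| <= #|Z|.
Proof.
move=> ex inj.
have ex' (u : {x | x \in S}) : exists y, y \in Z /\ Q (val u) y.
  by have [y] := ex _ (valP u); exists y.
have [h hP] := fin_all_exists ex'.
have h_inj : injective h.
  move=> u1 u2 e; apply: val_inj.
  have [_ q1] := hP u1; have [_ q2] := hP u2; rewrite -e in q2.
  exact: inj (valP u1) (valP u2) q1 q2.
rewrite -(card_sig (mem S)) -(card_codom h_inj); apply: subset_leq_card.
by apply/subsetP => y /codomP[u ->]; have [] := hP u.
Qed.

Lemma leq_card_dpair (X Y : finType) (S : {set X}) (P : X -> pred Y) m :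
  (forall x, x \in S -> m <= #|P x|) ->
  #|S| * m <= #|[pred z : X * Y | (z.1 \in S) && P z.1 z.2]|.
Proof.
move=> mP; rewrite -sum_nat_const -[X in _ <= X]sum1_card.
rewrite -(pair_big_dep (mem S) P (fun _ _ => 1)) /=.
by apply: leq_sum => x xS; rewrite sum1_card; apply: mP.
Qed.

Lemma card_ord_cnt (w : pred nat) s L :
  #|[pred t : 'I_L | w (s + t)]| + cnt w s = cnt w (s + L).
Proof.
rewrite /cnt iotaD count_cat addnC add0n; congr (_ + _).
rewrite cardE /enum_mem size_filter -enumT -[X in iota X]addn0 iotaDl.
by rewrite -val_enum_ord !count_map; apply: eq_count.
Qed.

Section Runs.
Context {d : Order.disp_t} (T : finPOrderType d) (D : {set T}).
Implicit Types (x y a : T) (f : {ffun T -> 'I_#|T|}) (g L l : nat).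

Local Notation LE := (linear_extensions T).
Local Notation word := (word D).
Local Notation relabels := (relabels D).

(* The letter b at p f is exchanged with any opposite letter of the block of  *)
(* length L starting at s (p f). The result determines f once p f - q f and   *)
(* the rank of the new b in the block are known.                              *)
Lemma run_count (b : bool) (S : {set {ffun T -> 'I_#|T|}})
    (p q : {ffun T -> 'I_#|T|} -> nat) (s : nat -> nat)
    (dec : nat -> nat -> nat) g L l :
  (forall f, f \in S -> [/\ f \in LE, word f (p f) = b,
     ~~ (s (p f) <= p f < s (p f) + L),
     exists2 c, c <= g & p f = dec (q f) c &
     cnt (letter b (word f)) (s (p f) + L) <
       cnt (letter b (word f)) (s (p f)) + l]) ->
  (forall f j, f \in S -> s (p f) <= j < s (p f) + L -> word f j = ~~ b ->
     exists f', [/\ f' \in LE, relabels f f', q f' = q f,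
       forall i, i != p f -> i != j -> word f' i = word f i &
       word f' j = b]) ->
  #|S| * (L - l) <= #|LE| * (g.+1 * l).
Proof.
move=> SP move_to.
(* Each [f] in [S] has fewer than [l] letters [b] in its block, hence at least [L - l] admissible
   positions [t]. *)
pose SX := [pred x : {ffun T -> 'I_#|T|} * 'I_L |
  (x.1 \in S) && ~~ letter b (word x.1) (s (p x.1) + x.2)].
pose Z := [pred y : {ffun T -> 'I_#|T|} * ('I_g.+1 * 'I_l) | y.1 \in LE].
apply: (@leq_trans #|SX|).
  apply: (@leq_card_dpair _ _ S
    (fun f (t : 'I_L) => ~~ letter b (word f) (s (p f) + t))).
  move=> f /SP[_ _ _ _ few].
  have := card_ord_cnt (letter b (word f)) (s (p f)) L.
  set m := #|[pred t : 'I_L | letter b (word f) (s (p f) + t)]| => e2.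
  apply: (@leq_trans (L - m)); first lia.
  rewrite -[X in X - m](card_ord L) -(cardC [pred t : 'I_L | letter b (word f) (s (p f) + t)]).
  by rewrite addKn; apply: eq_leq; apply: eq_card.
have -> : #|LE| * (g.+1 * l) = #|Z|.
  have -> : #|Z| = #|setX LE [set: 'I_g.+1 * 'I_l]|.
    by apply: eq_card => y; rewrite !inE andbT.
  by rewrite cardsX cardsT card_prod !card_ord.
pose Q (x : {ffun T -> 'I_#|T|} * 'I_L)
       (y : {ffun T -> 'I_#|T|} * ('I_g.+1 * 'I_l)) :=
  let f := x.1 in let j := s (p f) + x.2 in let f' := y.1 in
  [/\ p f = dec (q f) y.2.1, relabels f f', q f' = q f,
    (forall i, i != p f -> i != j -> word f' i = word f i) /\ word f' j = b &
    cnt (letter b (word f')) j =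
      cnt (letter b (word f')) (s (p f)) + y.2.2].
apply: (@leq_card_rel _ _ SX Z Q) => [[f t]|[f1 t1] [f2 t2] [f' [c k]]].
  rewrite inE /= => /andP[fS fj]; have [fL _ pb [c cg pc] few] := SP _ fS.
  have fj' : word f (s (p f) + t) = ~~ b.
    by move: fj; rewrite /letter; case: (word f _); case: (b).
  have jin : s (p f) <= s (p f) + t < s (p f) + L.
    by rewrite leq_addr ltn_add2l ltn_ord.
  have [f' [f'L r qf agree f'j]] := move_to _ _ fS jin fj'.
  have := @cnt_shift (letter b (word f)) (letter b (word f')) _ _ (leq_addr t (s (p f))).
  have hag i : s (p f) <= i < s (p f) + t ->
      letter b (word f') i = letter b (word f) i.
    by move=> hi; rewrite /letter agree //; apply/eqP => ?; lia.
  move=> /(_ hag) sh.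
  have m1 := leq_cnt (letter b (word f')) (leq_addr t (s (p f))).
  have m2 : cnt (letter b (word f)) (s (p f) + t) <=
    cnt (letter b (word f)) (s (p f) + L) by apply: leq_cnt; lia.
  have kl : cnt (letter b (word f')) (s (p f) + t) -
    cnt (letter b (word f')) (s (p f)) < l by lia.
  have cg' : c < g.+1 by [].
  exists (f', (Ordinal cg', Ordinal kl)); first by rewrite inE.
  by split=> //=; lia.
rewrite !inE /= => /andP[S1 j1] /andP[S2 j2].
move=> [/= p1 r1 q1 [a1 b1] k1] [/= p2 r2 q2 [a2 b2] k2].
have [L1 w1 _ _ _] := SP _ S1; have [L2 w2 _ _ _] := SP _ S2.
(* Decoding: [q f'] and the stored gap give [p], the stored rank gives the position of the new
   letter, and switching both letters back gives the word. *)
have pp : p f2 = p f1 by rewrite p1 p2 -q1 -q2.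
rewrite pp in k2 a2 b2 j2 w2.
have jj : s (p f1) + t1 = s (p f1) + t2.
  apply: (@cnt_inj (letter b (word f'))); rewrite /letter ?b1 ?b2 //.
  by rewrite -!/(letter _ _) k1 k2.
have tt : t1 = t2 by apply: val_inj; apply: (addnI jj).
subst t2; congr (_, _).
apply: (relabels_inj (linext_inj L1) (linext_inj L2) r1 r2) => i _.
case: (eqVneq i (p f1)) => [->|ip]; first by rewrite w1 w2.
case: (eqVneq i (s (p f1) + t1)) => [->|ij].
  by move: j1 j2; rewrite /letter; case: (word f1 _); case: (word f2 _); case: (b).
by rewrite -a1 // a2.
Qed.

Hypothesis D_down : forall x y, (x <= y)%O -> y \in D -> x \in D.

Variables (a : T).
Hypothesis D_lower : forall y, (y < a)%O -> y \in D.
Hypothesis D_upper : forall y, (a < y)%O -> y \notin D.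

Definition close g f x := upper_end f x <= lower_end f x + g.

(** The block ends just before the position of the last predecessor, which is not part of it. *)
Definition lower_rich L l f x :=
  l + cnt (word f) ((lower_end f x).-1 - L) <= cnt (word f) (lower_end f x).-1.

Definition upper_rich L l f x :=
  l + cnt (word f) (upper_end f x + L) <= cnt (word f) (upper_end f x) + L.

Lemma linext_swap f i j : f \in LE -> i < j -> j < #|T| ->
  word f i = false -> word f j = true ->
  exists f', [/\ f' \in LE, relabels f f',
    forall k, (k <= i) || (j < k) -> cnt (word f') k = cnt (word f) k,
    forall k, k != i -> k != j -> word f' k = word f k &
    word f' i = true /\ word f' j = false].
Proof.
move=> fL ij jn wi wj.
have [||||f' [f'L r ag c1 c2]] := @linext_exchange _ _ _ D_down f i j 1 1 fL.
- by rewrite addn1.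
- by rewrite addn1.
- by rewrite !addn1 cntS wi addn0 add1n.
- by rewrite addn1 cntS wj add1n addn1.
exists f'; split=> //.
- by move=> k hk; rewrite c1 // addn1.
- by move=> k ki kj; apply: ag; lia.
- have := c2 i.+1; have := c2 j; have := c1 i; have := c1 j.+1.
  rewrite !cntS wi wj leqnn !addn1 ltnS ij !leqnn orbT /= => /(_ isT) h1 /(_ isT) h2.
  by move=> /(_ isT) h3 /(_ isT) h4; case: (word f' i) h4; case: (word f' j) h1; lia.
Qed.

(** The last predecessor's letter moves back into the block. This leaves the later upper end alone,
    and closeness places the old position within [g] of it. *)
Lemma lower_run_count g L l :
  #|[set f in LE | [&& close g f a, L < lower_end f a & ~~ lower_rich L l f a]]|
    * (L - l) <= #|LE| * (g.+1 * l).
Proof.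
apply: (@run_count true _ (fun f => (lower_end f a).-1)
  (fun f => upper_end f a) (subn^~ L) (fun u c => u - c.+1)) => [f|f j];
  rewrite inE => /and4P[fL cl lL nr].
  have [|y ya ey] := @lower_end_ex _ _ f a; first lia.
  have f_inj := linext_inj fL.
  split=> //.
  - by rewrite ey /= word_val // D_lower.
  - lia.
  - have := lower_end_le_val a fL; have := upper_end_gt_val a fL => h1 h2.
    exists (upper_end f a - lower_end f a); first by move: cl; rewrite /close; lia.
    lia.
  - rewrite !cnt_letter_true subnK; last lia.
    by move: nr; rewrite /lower_rich; lia.
move=> hj wj.
have [|y ya ey] := @lower_end_ex _ _ f a; first lia.
have f_inj := linext_inj fL.
have wp : word f (lower_end f a).-1 = true by rewrite ey /= word_val // D_lower.
have pn : (lower_end f a).-1 < #|T| by rewrite ey /=.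
have [|f' [f'L r c ag [f'j f'p]]] := linext_swap fL _ pn wj wp; first lia.
exists f'; split=> //; last by move=> i ip ij; apply: ag.
have f'_inj := linext_inj f'L.
have h1 := lower_end_le_val a fL; have h2 := upper_end_gt_val a fL.
have up := upper_end_le f a; have up' := upper_end_le f' a.
apply/eqP; rewrite eqn_leq; apply/andP; split.
  (* The default value [#|T|.+1] bounds every upper end, so only attained upper ends need an
     argument. *)
  case: (leqP (upper_end f a) #|T|) => un; last by lia.
  rewrite leqNgt (relabels_upper_end_eq un D_upper f_inj f'_inj r) ?ltnn //.
  by apply: c; lia.
have un : (upper_end f a).-1 <= #|T| by lia.
suff: (upper_end f a).-1 < upper_end f' a by lia.
rewrite (relabels_upper_end_eq un D_upper f_inj f'_inj r); first lia.
by apply: c; lia.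
Qed.

(** Dual: the first successor's letter moves forward, and the unchanged lower end serves as the
    reference point. *)
Lemma upper_run_count g L l :
  #|[set f in LE | [&& close g f a, upper_end f a + L <= #|T| &
      ~~ upper_rich L l f a]]| * (L - l) <= #|LE| * (g.+1 * l).
Proof.
apply: (@run_count false _ (fun f => (upper_end f a).-1)
  (fun f => lower_end f a) succn (fun u c => (u + c).-1)) => [f|f j];
  rewrite inE => /and4P[fL cl lL nr].
  have [|y ya ey] := @upper_end_ex _ _ f a; first lia.
  have f_inj := linext_inj fL.
  split=> //.
  - by rewrite ey /= word_val // (negbTE (D_upper ya)).
  - lia.
  - have := lower_end_le_val a fL; have := upper_end_gt_val a fL => h1 h2.
    exists (upper_end f a - lower_end f a); first by move: cl; rewrite /close; lia.
    congr (_.-1); lia.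
  - rewrite !cnt_letter_false prednK; last lia.
    have := cnt_predC (word f) (upper_end f a + L).
    have := cnt_predC (word f) (upper_end f a).
    by move: nr; rewrite /upper_rich; lia.
move=> hj wj.
have [|y ya ey] := @upper_end_ex _ _ f a; first lia.
have f_inj := linext_inj fL.
have wp : word f (upper_end f a).-1 = false.
  by rewrite ey /= word_val // (negbTE (D_upper ya)).
have jn : j < #|T| by lia.
have [|f' [f'L r c ag [f'p f'j]]] := linext_swap fL _ jn wp wj; first lia.
exists f'; split=> //.
have f'_inj := linext_inj f'L.
have h1 := lower_end_le_val a fL; have h2 := upper_end_gt_val a fL.
have E k : k < upper_end f a -> (lower_end f' a <= k) = (lower_end f a <= k).
  move=> hk; apply: (relabels_lower_end_eq D_lower f_inj f'_inj r).
  by apply: c; lia.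
apply/eqP; rewrite eqn_leq E ?leqnn /=; last lia.
have := E (lower_end f a).-1; case: (posnP (lower_end f a)) => [->//|lp].
by lia.
Qed.

End Runs.

(** * Pairs of short windows *)

Section Pairs.
Context {d : Order.disp_t} (T : finPOrderType d) (D A : {set T}).
Implicit Types (x y a b : T) (f : {ffun T -> 'I_#|T|}).

Local Notation LE := (linear_extensions T).
Local Notation word := (word D).
Local Notation relabels := (relabels D).

Hypothesis D_down : forall x y, (x <= y)%O -> y \in D -> x \in D.
Hypothesis D_lower : forall x y, x \in A -> (y < x)%O -> y \in D.
Hypothesis D_upper : forall x y, x \in A -> (x < y)%O -> y \notin D.

Lemma upper_end_fixed f f' a : a \in A -> f \in LE -> f' \in LE ->
  relabels f f' -> upper_end f a <= #|T| ->
  (forall k, k <= upper_end f a -> cnt (word f') k = cnt (word f) k) ->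
  upper_end f' a = upper_end f a.
Proof.
move=> aA fL f'L r un c.
have E k : k <= upper_end f a -> (k < upper_end f' a) = (k < upper_end f a).
  move=> hk; apply: (relabels_upper_end_eq (leq_trans hk un) (@D_upper a ^~ aA)
    (linext_inj fL) (linext_inj f'L) r (c k hk)).
have h := upper_end_gt_val a fL.
by have := E _ (leqnn _); have := E (upper_end f a).-1; clear -h; lia.
Qed.

Lemma lower_end_fixed f f' b e : b \in A -> f \in LE -> f' \in LE ->
  relabels f f' -> lower_end f b = e.+1 ->
  (forall k, e <= k -> cnt (word f') k = cnt (word f) k) ->
  lower_end f' b = lower_end f b /\ upper_end f' b = upper_end f b.
Proof.
move=> bA fL f'L r le c; split.
  have E k : e <= k -> (lower_end f' b <= k) = (lower_end f b <= k).
    by move=> hk; apply: (relabels_lower_end_eq (@D_lower b ^~ bA)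
      (linext_inj fL) (linext_inj f'L) r (c k hk)).
  have := E _ (leqnn _); have := E _ (leqnSn _); rewrite le; clear; lia.
have E k : e <= k -> k <= #|T| -> (k < upper_end f' b) = (k < upper_end f b).
  move=> hk kn; apply: (relabels_upper_end_eq kn (@D_upper b ^~ bA)
    (linext_inj fL) (linext_inj f'L) r (c k hk)).
have h := upper_end_gt_val b fL; have h' := lower_end_le_val b fL.
have u := upper_end_le f b; have u' := upper_end_le f' b.
have := E (upper_end f b); have := E (upper_end f b).-1.
by rewrite le in h'; clear -h h' u u'; lia.
Qed.

(* Undoing the exchange would push the lower end of c past its upper end. *)
Lemma exchange_not_close f f' c g s1 s2 l : c \in A -> f \in LE -> f' \in LE ->
  relabels f f' -> g <= l.*2 -> s2 <= #|T| ->
  (forall k, s1 <= k <= s2 -> cnt (word f') k = cnt (word f) k + l) ->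
  s1 < lower_end f' c -> upper_end f' c <= s2 -> ~~ close g f' c.
Proof.
move=> cA fL f'L r gl sn mid lo up; rewrite /close -ltnNge.
have i := linext_inj fL; have i' := linext_inj f'L; have r' := relabels_sym r.
have h1 := upper_end_gt_val c fL; have h2 := lower_end_le_val c fL.
have h1' := upper_end_gt_val c f'L; have h2' := lower_end_le_val c f'L.
have lou : lower_end f' c <= upper_end f' c by clear -h1' h2'; lia.
have lu : l <= upper_end f' c.
  have := mid (upper_end f' c); have := cnt_predC (word f') (upper_end f' c).
  by clear -lou lo up; lia.
(* A stretch of [l] positions holds at most [l] D-letters, so taking [l] of them out of the prefix
   delays the lower end by at least [l]. *)
have hl : lower_end f' c + l <= lower_end f c.
  rewrite leqNgt; apply/negP => hlt.
  suff: lower_end f' c <= (lower_end f' c).-1 by clear -lo; lia.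
  apply: (relabels_lower_end (@D_lower c ^~ cA) i' i r'
    (k' := (lower_end f' c).-1 + l)); last by clear -lo hlt; lia.
  by rewrite mid ?leq_cnt_add //; clear -lo up lou; lia.
have hu : upper_end f c <= upper_end f' c - l.
  rewrite leqNgt; apply/negP => hlt.
  suff: upper_end f' c < upper_end f' c by rewrite ltnn.
  have un : upper_end f' c <= #|T| := leq_trans up sn.
  apply: (relabels_upper_end (@D_upper c ^~ cA) i' i r' _ _ _ hlt) => //.
    exact: leq_trans (leq_subr _ _) un.
  have := cnt_predC (word f') (upper_end f' c).
  have := cnt_predC (word f) (upper_end f' c - l).
  have := leq_cnt (word f) (leq_subr l (upper_end f' c)).
  by rewrite mid; clear -lo up lou lu; lia.
(* The ends approach each other by [l] each, and [f c] still lies between them, so the gap in [f']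
   exceeds [l.*2 >= g]. *)
clear -h1 h2 hl hu gl lu; lia.
Qed.

Variables g L l : nat.

Definition good_window f x := [&& close g f x, L < lower_end f x,
  lower_rich D L l f x, upper_end f x + L <= #|T| & upper_rich D L l f x].

Definition far_windows f a b := upper_end f a + L <= (lower_end f b).-1 - L.

(** Number of codes: a residue of the lower end of [b], the offset of [b] from it, and the original
    contents of the two blocks. *)
Definition pair_cost := (L + g).+1 * g.+1 * (2 ^ L * 2 ^ L).

(** The pair is encoded by the exchanged extension and a code of bounded size. The exchange fixes
    the upper end of [a] and both ends of [b], and spoils the windows between the blocks, so few
    windows can be that of [b]. *)
Lemma pair_count a : a \in A -> g <= l.*2 ->
  #|[pred z : {ffun T -> 'I_#|T|} * T |
      [&& z.1 \in LE, z.2 \in A, good_window z.1 a, good_window z.1 z.2 &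
          far_windows z.1 a z.2]]|
    <= #|LE| * pair_cost.
Proof.
move=> aA gl.
pose code := ('I_(L + g).+1 * 'I_g.+1 *
              ({ffun 'I_L -> bool} * {ffun 'I_L -> bool}))%type.
pose Z := [pred y : {ffun T -> 'I_#|T|} * code | y.1 \in LE].
have -> : #|LE| * pair_cost = #|Z|.
  have -> : #|Z| = #|setX LE [set: code]|.
    by apply: eq_card => y; rewrite !inE andbT.
  by rewrite cardsX cardsT !card_prod !card_ffun !card_ord card_bool.
pose block (w : pred nat) s : {ffun 'I_L -> bool} := [ffun t : 'I_L => w (s + t)].
pose Q (x : {ffun T -> 'I_#|T|} * T) (y : {ffun T -> 'I_#|T|} * code) :=
  let f := x.1 in let b := x.2 in let f' := y.1 in
  let s1 := upper_end f a in let s2 := (lower_end f b).-1 - L in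
  [/\ [/\ f' \in LE, relabels f f',
        forall i, ~~ (s1 <= i < s1 + L) -> ~~ (s2 <= i < s2 + L) ->
          word f' i = word f i,
        forall k, (k <= s1) || (s2 + L <= k) ->
          cnt (word f') k = cnt (word f) k &
        forall k, s1 + L <= k <= s2 -> cnt (word f') k = cnt (word f) k + l],
      y.2.1.1 = lower_end f b %% (L + g).+1 :> nat,
      f b = lower_end f b + y.2.1.2 :> nat,
      block (word f) s1 = y.2.2.1 & block (word f) s2 = y.2.2.2].
apply: (@leq_card_rel _ _ _ Z Q) => [[f b]|[f1 b1] [f2 b2] [f' [[c o] [B1 B2]]]].
  rewrite inE /= => /and5P[fL bA ga gb fr].
  have /and5P[_ _ _ _ ra] := ga; have /and5P[cb lb rb ub _] := gb.
  have h1 := lower_end_le_val b fL; have h2 := upper_end_gt_val b fL.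
  have e : (lower_end f b).-1 - L + L = (lower_end f b).-1.
    by apply: subnK; clear -lb; lia.
  have [||f' [p1 p2 p3 p4 p5]] := linext_exchange D_down fL fr _ ra.
  - by rewrite e (leq_trans (leq_pred _)) // (leq_trans h1) // ltnW.
  - by rewrite e; apply: rb.
  have cl : lower_end f b %% (L + g).+1 < (L + g).+1 by rewrite ltn_mod.
  have ol : f b - lower_end f b < g.+1.
    by rewrite ltnS leq_subLR (leq_trans (ltnW (ltnW h2)) cb).
  exists (f', (Ordinal cl, Ordinal ol, (block (word f) (upper_end f a),
    block (word f) ((lower_end f b).-1 - L)))); first by rewrite inE.
  by split=> //=; rewrite subnKC.
rewrite inE /= => /and5P[f1L b1A ga1 gb1 fr1].
rewrite inE /= => /and5P[f2L b2A ga2 gb2 fr2].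
move=> [/= [f'L r1 ag1 out1 mid1] c1 o1 B11 B12].
move=> [/= [_ r2 ag2 out2 mid2] c2 o2 B21 B22].
have key h (hL : h \in LE) (r : relabels h f') b : b \in A ->
    good_window h a -> good_window h b ->
    (forall k, (k <= upper_end h a) || ((lower_end h b).-1 - L + L <= k) ->
      cnt (word f') k = cnt (word h) k) ->
    [/\ upper_end f' a = upper_end h a, lower_end f' b = lower_end h b,
        close g f' b & L < lower_end h b].
  move=> bA /and5P[_ _ _ ua _] /and5P[cb lb _ _ _] out.
  have [||lb' ub'] := @lower_end_fixed h f' b (lower_end h b).-1 bA hL f'L r.
  - by rewrite prednK //; clear -lb; lia.
  - by move=> k hk; apply: out; rewrite subnK ?hk ?orbT //; clear -lb; lia.
  split=> //; last by rewrite /close lb' ub'.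
  apply: (@upper_end_fixed _ _ _ aA hL f'L r) => [|k hk].
    by clear -ua; lia.
  by apply: out; rewrite hk.
have [ua1 lb1 cb1 L1] := key _ f1L r1 _ b1A ga1 gb1 out1.
have [ua2 lb2 cb2 L2] := key _ f2L r2 _ b2A ga2 gb2 out2.
(* A close window starting beyond the early block and at least [L + g + 1] before that of [b'] would
   lie between the blocks, against [exchange_not_close]. *)
have ncl h (hL : h \in LE) (r : relabels h f') b' b : b \in A ->
    upper_end f' a = upper_end h a -> lower_end h b' <= #|T| ->
    (forall k, upper_end h a + L <= k <= (lower_end h b').-1 - L ->
      cnt (word f') k = cnt (word h) k + l) ->
    upper_end f' a + L <= (lower_end f' b).-1 - L -> L < lower_end f' b ->
    lower_end f' b + (L + g).+1 <= lower_end h b' -> ~~ close g f' b.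
  move=> bA ua un mid fr Lb far'; apply/negP => cb.
  suff : ~~ close g f' b by rewrite cb.
  apply: (@exchange_not_close h f' b g (upper_end h a + L)
    ((lower_end h b').-1 - L) l bA hL f'L r gl) => //.
  - by clear -un; lia.
  - by rewrite -ua; clear -fr Lb; lia.
  - by move: cb; rewrite /close; clear -far'; lia.
have bn h b : h \in LE -> lower_end h b <= #|T|.
  by move=> /(lower_end_le_val b) hb; apply: leq_trans hb (ltnW (ltn_ord _)).
(* Distinct congruent lower ends are at least [L + g + 1] apart, so the earlier of the two windows
   contradicts [ncl]; this dictates the modulus. *)
have ee : lower_end f1 b1 = lower_end f2 b2.
  have cc : lower_end f1 b1 = lower_end f2 b2 %[mod (L + g).+1] by rewrite -c1 -c2.
  case: (ltngtP (lower_end f1 b1) (lower_end f2 b2)) => // lt.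
    suff : ~~ close g f' b1 by rewrite cb1.
    apply: (ncl _ f2L r2 b2) => //; rewrite ?lb1 ?ua1 ?bn //.
    have : (L + g).+1 %| lower_end f2 b2 - lower_end f1 b1.
      by rewrite -eqn_mod_dvd ?(ltnW lt) // cc.
    by move=> /dvdn_leq; rewrite subn_gt0 lt => /(_ isT); clear -lt; lia.
  suff : ~~ close g f' b2 by rewrite cb2.
  apply: (ncl _ f1L r1 b1) => //; rewrite ?lb2 ?ua2 ?bn //.
  have : (L + g).+1 %| lower_end f1 b1 - lower_end f2 b2.
    by rewrite -eqn_mod_dvd ?(ltnW lt) // cc.
  by move=> /dvdn_leq; rewrite subn_gt0 lt => /(_ isT); clear -lt; lia.
have uu : upper_end f1 a = upper_end f2 a by rewrite -ua1.
have blockE (w1 w2 : pred nat) s : block w1 s = block w2 s ->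
    forall i, s <= i < s + L -> w1 i = w2 i.
  move=> /ffunP e i /andP[si iL]; have tL : i - s < L by clear -si iL; lia.
  by have := e (Ordinal tL); rewrite !ffunE /= subnKC.
(* Outside the blocks both words agree with that of [f']; inside, the code stores them. *)
have f12 : f1 = f2.
  apply: (relabels_inj (linext_inj f1L) (linext_inj f2L) r1 r2) => i _.
  case: (boolP (upper_end f1 a <= i < upper_end f1 a + L)) => [hi|n1].
    by apply: blockE hi; rewrite B11 uu.
  case: (boolP ((lower_end f1 b1).-1 - L <= i < (lower_end f1 b1).-1 - L + L)) => [hi|n2].
    by apply: blockE hi; rewrite B12 ee.
  by rewrite -ag1 // ag2 // -?uu -?ee.
subst f2; congr (_, _); apply: (linext_inj f1L); apply: val_inj => /=.
by rewrite o1 o2 ee.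
Qed.

End Pairs.

(** * The second moment of the number of short windows *)

Lemma sum_dpair_card (X Y : finType) (S : {set X}) (B : {set Y})
    (P : X -> Y -> bool) :
  \sum_(x in S) \sum_(y in B) (P x y : nat) =
  #|[pred z : X * Y | [&& z.1 \in S, z.2 \in B & P z.1 z.2]]|.
Proof.
rewrite -sum1_card pair_big_dep /= [RHS]big_mkcond [LHS]big_mkcond /=.
apply: eq_bigr => -[x y] _ /=; rewrite inE /=.
by case: (x \in S); case: (y \in B); case: (P x y).
Qed.

Lemma sum_bool_card (X : finType) (S : {set X}) (P : pred X) :
  \sum_(x in S) (P x : nat) = #|[set x in S | P x]|.
Proof.
rewrite -sum1_card [RHS]big_mkcond [LHS]big_mkcond /=.
by apply: eq_bigr => x _; rewrite inE; case: (x \in S); case: (P x).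
Qed.

(** Sort by the size of the principal down-set, which grows strictly along the order. *)
Lemma linext_exists (d : Order.disp_t) (T : finPOrderType d) :
  0 < #|linear_extensions T|.
Proof.
pose r (x y : T) := #|[set z : T | (z <= x)%O]| <= #|[set z : T | (z <= y)%O]|.
have r_total : total r by move=> x y; apply: leq_total.
have r_trans : transitive r by move=> y x z; apply: leq_trans.
have r_refl : reflexive r by move=> x; apply: leqnn.
pose s := sort r (enum T).
have ms x : x \in s by rewrite mem_sort mem_enum.
have sz : size s = #|T| by rewrite size_sort -cardE.
have ix x : index x s < #|T| by rewrite -sz index_mem.
apply/card_gt0P; exists [ffun x => Ordinal (ix x)]; rewrite inE.
apply/andP; split.
  apply/injectiveP => x y; rewrite !ffunE => /(congr1 val) /= e.
  by rewrite -(nth_index x (ms x)) e nth_index.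
apply/forallP => x; apply/forallP => y; apply/implyP => xy; rewrite !ffunE /=.
case: (eqVneq x y) => [->//|nxy]; rewrite leqNgt; apply/negP => lt.
have := sorted_leq_index r_trans r_refl (sort_sorted r_total _) _ _ (ms y) (ms x).
move=> /(_ (ltnW lt)); rewrite /r leqNgt proper_card //; apply/properP; split.
  by apply/subsetP => z; rewrite !inE => zx; apply: le_trans zx xy.
exists y; rewrite inE ?lexx //; apply: contra nxy => yx.
by apply/eqP/le_anti; rewrite xy yx.
Qed.

Lemma inj_interval_card (T : finType) n (f : T -> 'I_n) (S : {set T}) s m :
  injective f -> (forall x, x \in S -> s <= f x < s + m) -> #|S| <= m.
Proof.
move=> f_inj fS; rewrite -(card_imset (mem S) f_inj) cardE -(size_iota s m).
rewrite -(size_map val); apply: uniq_leq_size.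
  by rewrite map_inj_uniq ?enum_uniq //; apply: val_inj.
move=> i /mapP[j]; rewrite mem_enum => /imsetP[x xS ->] ->.
by rewrite mem_iota; apply: fS.
Qed.

Section SecondMoment.
Context {d : Order.disp_t} (T : finPOrderType d) (A : {set T}) (m : nat).
Implicit Types (x y a b : T) (f : {ffun T -> 'I_#|T|}).

Local Notation LE := (linear_extensions T).

Hypothesis A_anti : antichain A.
Hypothesis A_short : forall x, x \in A ->
  \sum_(f in LE) (upper_end f x - lower_end f x) <= m * #|LE|.

Let D := [set y : T | [exists a in A, (y < a)%O]].
(** [g] makes Markov's inequality lose at most a quarter; [l] is positive with [g <= l.*2];
    [L - l = 8 * (g.+1 * l)] makes each kind of poor run cost at most an eighth; good windows whose
    elements are at least [W] apart are far. *)
Let g := 4 * m.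
Let l := (2 * m).+1.
Let L := l + 8 * (g.+1 * l).
Let W := 2 * (g + L).
Let good := good_window D g L l.
Let far := @far_windows d T L.

Lemma below_antichain_down x y : (x <= y)%O -> y \in D -> x \in D.
Proof.
rewrite !inE => xy /existsP[a /andP[aA ya]]; apply/existsP; exists a.
by rewrite aA (le_lt_trans xy ya).
Qed.

Lemma below_antichain_lower x y : x \in A -> (y < x)%O -> y \in D.
Proof. by move=> xA yx; rewrite inE; apply/existsP; exists x; rewrite xA. Qed.

Lemma below_antichain_upper x y : x \in A -> (x < y)%O -> y \notin D.
Proof.
move=> xA xy; rewrite inE; apply/existsP => -[a /andP[aA ya]].
have xa := lt_trans xy ya.
move: A_anti => /forallP/(_ x)/implyP/(_ xA)/forallP/(_ a)/implyP/(_ aA).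
by rewrite (ltW xa) /= => /eqP e; rewrite e ltxx in xa.
Qed.

(** Markov's inequality: a window that is not close has length at least [4 * m + 1]. *)
Lemma not_close_count x : x \in A ->
  4 * #|[set f in LE | ~~ close g f x]| <= #|LE|.
Proof.
move=> xA; set S := [set f in LE | _].
have h : #|S| * g.+1 <= m * #|LE|.
  apply: leq_trans (A_short xA).
  rewrite -sum_nat_const big_mkcond [leqRHS]big_mkcond /=.
  apply: leq_sum => f _; rewrite inE; case: (f \in LE) => //=.
  by case: ifP => //; rewrite /close -ltnNge; lia.
by move: h; rewrite /g; clear; nia.
Qed.

Lemma lower_poor_count x : x \in A ->
  8 * #|[set f in LE | [&& close g f x, L < lower_end f x &
    ~~ lower_rich D L l f x]]| <= #|LE|.
Proof.
move=> xA; have := @lower_run_count _ T D below_antichain_down x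
  (@below_antichain_lower x ^~ xA) (@below_antichain_upper x ^~ xA) g L l.
rewrite {2}/L addKn mulnA leq_pmul2r; first by rewrite mulnC.
by rewrite /l.
Qed.

Lemma upper_poor_count x : x \in A ->
  8 * #|[set f in LE | [&& close g f x, upper_end f x + L <= #|T| &
    ~~ upper_rich D L l f x]]| <= #|LE|.
Proof.
move=> xA; have := @upper_run_count _ T D below_antichain_down x
  (@below_antichain_lower x ^~ xA) (@below_antichain_upper x ^~ xA) g L l.
rewrite {2}/L addKn mulnA leq_pmul2r; first by rewrite mulnC.
by rewrite /l.
Qed.

(** This exception is bounded for every single extension: such elements all lie in the first [L + g]
    positions. *)
Lemma lower_edge_count f : f \in LE ->
  #|[set x in A | close g f x && (lower_end f x <= L)]| <= L + g.
Proof.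
move=> fL; apply: (@inj_interval_card _ _ f _ 0); first exact: linext_inj fL.
move=> x; rewrite inE => /and3P[_]; rewrite /close => c lx.
by have := upper_end_gt_val x fL; clear -c lx; lia.
Qed.

Lemma upper_edge_count f : f \in LE ->
  #|[set x in A | close g f x && (#|T| < upper_end f x + L)]| <= L + g.
Proof.
move=> fL; apply: (@inj_interval_card _ _ f _ (#|T| - (L + g))).
  exact: linext_inj fL.
move=> x; rewrite inE => /and3P[_]; rewrite /close => c lx.
have := lower_end_le_val x fL; have := ltn_ord (f x).
by clear -c lx; lia.
Qed.

Definition num_good f := \sum_(x in A) (good f x : nat).

(** A window that is not good is not close, poor on one side, or near an edge. The first two reasons
    take fractions 1/4 + 1/8 + 1/8 of all pairs, each edge at most [L + g] elements per
    extension. *)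
Lemma sum_num_good :
  #|A| * #|LE| <= 2 * \sum_(f in LE) num_good f + 4 * ((L + g) * #|LE|).
Proof.
pose nc f x : nat := ~~ close g f x.
pose le f x : nat := close g f x && (lower_end f x <= L).
pose ue f x : nat := close g f x && (#|T| < upper_end f x + L).
pose lp f x : nat := [&& close g f x, L < lower_end f x & ~~ lower_rich D L l f x].
pose up f x : nat :=
  [&& close g f x, upper_end f x + L <= #|T| & ~~ upper_rich D L l f x].
have H1 : #|A| * #|LE| <= \sum_(f in LE) \sum_(x in A)
    (good f x + (nc f x + (le f x + (ue f x + (lp f x + up f x))))).
  rewrite mulnC -sum_nat_const; apply: leq_sum => f _.
  rewrite -sum1_card; apply: leq_sum => x _.
  rewrite /good /good_window /nc /le /ue /lp /up.
  rewrite [L < _]ltnNge [#|T| < _]ltnNge.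
  case: (close g f x); case: (lower_end f x <= L) => //=;
    case: (upper_end f x + L <= #|T|); case: (lower_rich D L l f x);
    by case: (upper_rich D L l f x).
have H2 : 4 * \sum_(f in LE) \sum_(x in A) nc f x <= #|A| * #|LE|.
  rewrite exchange_big -sum_nat_const big_distrr; apply: leq_sum => x xA.
  by rewrite /= sum_bool_card not_close_count.
have H3 : 8 * \sum_(f in LE) \sum_(x in A) lp f x <= #|A| * #|LE|.
  rewrite exchange_big -sum_nat_const big_distrr; apply: leq_sum => x xA.
  by rewrite /= sum_bool_card lower_poor_count.
have H4 : 8 * \sum_(f in LE) \sum_(x in A) up f x <= #|A| * #|LE|.
  rewrite exchange_big -sum_nat_const big_distrr; apply: leq_sum => x xA.
  by rewrite /= sum_bool_card upper_poor_count.
have H5 : \sum_(f in LE) \sum_(x in A) le f x <= (L + g) * #|LE|.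
  rewrite mulnC -sum_nat_const; apply: leq_sum => f fL.
  by rewrite sum_bool_card lower_edge_count.
have H6 : \sum_(f in LE) \sum_(x in A) ue f x <= (L + g) * #|LE|.
  rewrite mulnC -sum_nat_const; apply: leq_sum => f fL.
  by rewrite sum_bool_card upper_edge_count.
move: H1; under eq_bigr do rewrite !big_split /=.
rewrite !big_split /= => H1.
have arith X Y k n1 n2 n3 n4 n5 : 4 * n1 <= X -> 8 * n4 <= X -> 8 * n5 <= X ->
    n2 <= Y -> n3 <= Y -> X <= k + (n1 + (n2 + (n3 + (n4 + n5)))) ->
    X <= 2 * k + 4 * Y by clear; lia.
exact: arith H2 H3 H4 H5 H6 H1.
Qed.

Definition far_pairs f :=
  \sum_(a in A) \sum_(b in A) ([&& good f a, good f b & far f a b] : nat).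

(** The square counts ordered pairs of good elements; each is far in one of the two directions or
    has labels less than [W] apart, which leaves at most [2 * W] partners for each [a]. *)
Lemma num_good_sqr f : f \in LE ->
  num_good f * num_good f <= far_pairs f + far_pairs f + 2 * W * #|A|.
Proof.
move=> fL; rewrite {1 2}/num_good big_distrlr /= /far_pairs.
rewrite [X in _ <= _ + X + _]exchange_big /= mulnC -sum_nat_const -!big_split /=.
apply: leq_sum => a aA.
pose near b := (f a < f b + W) && (f b < f a + W).
have nearW : \sum_(b in A) (near b : nat) <= 2 * W.
  rewrite sum_bool_card.
  apply: (@inj_interval_card _ _ f _ ((f a).+1 - W)); first exact: linext_inj fL.
  by move=> b; rewrite inE /near => /and3P[_]; clear; lia.
apply: leq_trans (leq_add (leqnn _) nearW); rewrite -!big_split /=.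
apply: leq_sum => b bA.
case ga: (good f a); case gb: (good f b) => //=.
move: ga gb; rewrite /good /good_window => /and5P[ca la _ _ _] /and5P[cb lb _ _ _].
have h1 := lower_end_le_val a fL; have h2 := upper_end_gt_val a fL.
have h3 := lower_end_le_val b fL; have h4 := upper_end_gt_val b fL.
suff: [|| far f a b, far f b a | near b].
  by case: (far f a b); case: (far f b a); case: (near b).
move: ca cb; rewrite /near /far /far_windows /close /W.
by clear -la lb h1 h2 h3 h4; lia.
Qed.

Lemma antichain_bounded :
  #|A| <= 32 * (pair_cost g L + W) + 8 * (L + g).
Proof.
have e0 := linext_exists T.
have S1 := sum_num_good.
set C := pair_cost g L.
have S2 : \sum_(f in LE) num_good f * num_good f <=
    2 * (#|A| * (#|LE| * C)) + 2 * W * #|A| * #|LE|.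
  apply: (@leq_trans (\sum_(f in LE)
    (far_pairs f + far_pairs f + 2 * W * #|A|))); first exact: leq_sum num_good_sqr.
  have P : \sum_(f in LE) far_pairs f <= #|A| * (#|LE| * C).
    rewrite exchange_big -sum_nat_const; apply: leq_sum => a aA /=.
    rewrite sum_dpair_card; apply: pair_count aA _ => //.
    - exact: below_antichain_down.
    - exact: below_antichain_lower.
    - exact: below_antichain_upper.
    - by rewrite /g /l; lia.
  rewrite !big_split /= sum_nat_const [#|LE| * (2 * W * _)]mulnC leq_add2r.
  by rewrite mul2n -addnn leq_add.
(* Summing 2(4K)N <= (4K)^2 + N^2 replaces Cauchy-Schwarz; the weight 4 matches a mean of at least
   N/4. *)
have S3 : 8 * (#|A| * \sum_(f in LE) num_good f) <=
    16 * (\sum_(f in LE) num_good f * num_good f) + #|A| * #|A| * #|LE|.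
  rewrite [X in _ <= _ + X]mulnC -[X in _ <= _ + X]sum_nat_const.
  rewrite !big_distrr -big_split /=.
  apply: leq_sum => f _; move: #|A| (num_good f) => N K.
  have := nat_Cauchy (4 * K) N; rewrite !expnS !expn0 !muln1 mulnACA -mulnA mulnA.
  by case; rewrite [K * N]mulnC.
rewrite leqNgt; apply/negP => big.
move: e0 S1 S2 S3 big.
move: (\sum_(f in LE) num_good f) (\sum_(f in LE) num_good f * num_good f).
move: #|LE| #|A| C W (L + g) => e N C' W' G K K2; clear => e0 S1 S2 S3 big.
have N0 : 0 < N by lia.
have Ne0 : 0 < N * e by rewrite muln_gt0 N0.
have Ge : 8 * G * e <= N * e by rewrite leq_mul2r; lia.
(* The edge term is at most half of [N * e], so the first moment is at least [N * e / 4]. With [S3]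
   and [S2] this forces [N <= 32 * (C' + W')]. *)
have NK : N * (N * e) <= N * (4 * K) by rewrite leq_mul2l; lia.
have CW : (32 * (C' + W')).+1 * (N * e) <= N * (N * e).
  by rewrite leq_mul2r; lia.
lia.
Qed.

End SecondMoment.

(** * From bounded antichains to the width *)

Lemma short_antichain_bounded m : exists N, forall (d : Order.disp_t)
    (T : finPOrderType d) (A : {set T}), antichain A ->
  (forall x, x \in A -> \sum_(f in linear_extensions T)
     (upper_end f x - lower_end f x) <= m * #|linear_extensions T|) ->
  #|A| < N.
Proof.
(* The bound depends on [m] alone, so it can be chosen before the poset and is found by
   unification. *)
eexists (S _) => d T A anti short; rewrite ltnS.
exact: antichain_bounded anti short.
Qed.

Lemma width_antichain (d : Order.disp_t) (T : finPOrderType d) :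
  exists2 A : {set T}, antichain A & width T = #|A|.
Proof.
have ex : 0 < #|[pred A : {set T} | antichain A]|.
  apply/card_gt0P; exists set0; rewrite inE.
  by apply/forallP => x; rewrite inE.
by have [A An e] := eq_bigmax_cond (fun A : {set T} => #|A|) ex; exists A.
Qed.

Local Open Scope ring_scope.

Theorem theorem2p2 (R : realType) (M : R) (hM : 0 < M) :
  exists N : nat, forall (d : Order.disp_t) (P : finPOrderType d),
    (N <= width P)%N -> M <= poset_window P R.
Proof.
have [N NP] := short_antichain_bounded (Num.bound M).
exists N => d P; have [A anti ->] := width_antichain P.
(* Contrapositive: if every window is below [M], the integer bound above [M] serves as the mean
   bound [m] on a maximum antichain. *)
apply: contraTT; rewrite -ltNge -ltnNge => short; apply: NP => // x _.
have e0 : 0 < #|linear_extensions P|%:R :> R by rewrite ltr0n linext_exists.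
have : window R x < (Num.bound M)%:R.
  apply: le_lt_trans (lt_trans short (archi_boundP (ltW hM))).
  exact: le_bigmax.
rewrite /window /mean_linext ltr_pdivrMr // -natrM => /ltW.
rewrite -(ler_nat R) natr_sum; apply: le_trans; rewrite le_eqVlt; apply/orP; left.
(* Truncated subtraction agrees with the real one because the lower end stays below the upper
   end. *)
apply/eqP; apply: eq_bigr => f fL; rewrite natrB //.
have lo := lower_end_le_val x fL; apply: leq_trans lo _.
exact: ltnW (ltnW (upper_end_gt_val x fL)).
Qed.
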